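(* Let $d\in\mathbb{N}$, $V:\mathbb{Z}^d\to\mathbb{R}$, $N\in\mathbb{N}$, $\lambda\in\mathbb{R}$, and let $w:\mathbb{Z}^d\to\mathbb{R}$ be a strictly positive supersolution of $(H_V-\lambda)\psi=0$ in $\mathbb{Z}^d_{\geq N}$. Suppose further that $u:\mathbb{Z}^d\to\mathbb{R}$ is a subsolution of $(H_V-\lambda)\psi=0$ in $\mathbb{Z}^d_{\geq N}$ satisfying $$\liminf_{M\to\infty}\frac{1}{M^2}\sum_{M\leq|n|\leq\alpha M}\ \sum_{j=1}^{d}|u_nu_{n-\delta_j}|=0$$ for some $\alpha>1$ (the outer sum is over $n\in\mathbb{Z}^d$). Then, for all $n\in\mathbb{Z}^d_{\geq N}$, one has $$u_n\leq Cw_n,$$ where $C$ is any positive constant such that $$C\geq\max\left\{\frac{u_n}{w_n}\ \Big|\ n\in\mathbb{Z}^d,\ N-1\leq|n|<N+1\right\}.$$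
   Context: $|\cdot|$ is the Euclidean norm, $\delta_j$ is the $j$-th standard basis vector of $\mathbb{Z}^d$, and $\mathbb{Z}^d_{\geq N}:=\{n\in\mathbb{Z}^d: |n|\geq N\}$. For any $\psi:\mathbb{Z}^d\to\mathbb{R}$ (not necessarily square-summable), $(H_V\psi)_n:=\sum_{m\in\mathbb{Z}^d,\,|m-n|=1}(\psi_n-\psi_m)+V_n\psi_n$. For $\Omega\subset\mathbb{Z}^d$, functions $u,w:\mathbb{Z}^d\to\mathbb{R}$ are called a subsolution, respectively supersolution, of $(H_V-\lambda)\psi=0$ in $\Omega$ if $[(H_V-\lambda)u]_n\leq0$, respectively $[(H_V-\lambda)w]_n\geq0$, for all $n\in\Omega$. Strictly positive means $w_n>0$ for all $n\in\mathbb{Z}^d$. *)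

(* Defs.v *)
From HB Require Import structures.
From mathcomp Require Import all_boot all_order all_algebra.
From mathcomp Require Import all_classical all_reals all_analysis.
From mathcomp Require Import zify.
Import Order.TTheory GRing.Theory Num.Theory.
Import numFieldNormedType.Exports.

Set Implicit Arguments.
Unset Strict Implicit.
Unset Printing Implicit Defensive.

Local Open Scope classical_set_scope.
Local Open Scope ring_scope.

(* Z^d is ['rV[int]_d]; its j-th standard basis vector is [delta_mx 0 j].
   [`|n|] on row vectors is the sup norm, hence a separate Euclidean norm. *)
Definition enorm (R : realType) (d : nat) (n : 'rV[int]_d) : R :=
  Num.sqrt (\sum_(i < d) ((n 0 i)%:~R : R) ^+ 2).

Definition outside_ball (R : realType) (d N : nat) : set 'rV[int]_d :=
  [set n | N%:R <= enorm R n].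

Definition schrodinger (R : realType) (d : nat) (V psi : 'rV[int]_d -> R)
    (n : 'rV[int]_d) : R :=
  \sum_(m \in [set m | enorm R (m - n) = 1]) (psi n - psi m) + V n * psi n.

Definition subsolution (R : realType) (d : nat) (V : 'rV[int]_d -> R)
    (lambda : R) (Omega : set 'rV[int]_d) (u : 'rV[int]_d -> R) : Prop :=
  forall n, Omega n -> schrodinger V u n - lambda * u n <= 0.

Definition supersolution (R : realType) (d : nat) (V : 'rV[int]_d -> R)
    (lambda : R) (Omega : set 'rV[int]_d) (w : 'rV[int]_d -> R) : Prop :=
  forall n, Omega n -> 0 <= schrodinger V w n - lambda * w n.

Definition annulus_sum (R : realType) (d : nat) (u : 'rV[int]_d -> R)
    (alpha M : R) : R :=
  \sum_(n \in [set n | M <= enorm R n <= alpha * M])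
    \sum_(j < d) `|u n * u (n - delta_mx 0 j)|.

(* [\sum_(n \in A)] is 0 when infinitely many terms are nonzero; finiteness of
   balls rules this out for the sums above. It likewise makes the supremum of a
   real function over a bounded nonempty region of Z^d a maximum. *)
Lemma finite_enorm_ball (R : realType) (d : nat) (r : R) :
  finite_set [set n : 'rV[int]_d | enorm R n <= r].
Proof.
pose K := Num.bound r.
pose f (g : {ffun 'I_d -> 'I_(K + K)}) : 'rV[int]_d :=
  \row_i ((g i : nat)%:Z - K%:Z).
apply: (@sub_finite_set _ _ (f @` setT)); last exact/finite_image/finite_finset.
move=> n /= nr.
have nK i : (absz (n 0%R i) < K)%N.
  rewrite -(ltr_nat R) natr_absz; apply: le_lt_trans (_ : r < _).
    apply: le_trans nr; rewrite intr_norm -sqrtr_sqr ler_sqrt.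
      by rewrite (bigD1 i)//= lerDl sumr_ge0// => j _; exact: sqr_ge0.
    by rewrite sumr_ge0// => j _; exact: sqr_ge0.
  apply: archi_boundP; apply: le_trans nr; exact: sqrtr_ge0.
have nK2 i : (absz (n 0%R i + K%:Z)%R < K + K)%N by have := nK i; lia.
exists [ffun i => Ordinal (nK2 i)] => //.
by apply/rowP => i; rewrite mxE ffunE /=; have := nK i; lia.
Qed.

Lemma finite_neighbours (R : realType) (d : nat) (n : 'rV[int]_d) :
  finite_set [set m | enorm R (m - n) = 1].
Proof.
apply: (@sub_finite_set _ _ ((fun k => k + n) @` [set k | enorm R k <= 1])).
  by move=> m /= mn; exists (m - n); rewrite /= ?mn// subrK.
exact/finite_image/finite_enorm_ball.
Qed.

(* Main.v *)
Require Import Defs.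
From mathcomp Require Import all_boot all_order all_algebra.
From mathcomp Require Import all_classical all_reals all_analysis.
From mathcomp Require Import ring lra zify.
Import Order.TTheory GRing.Theory Num.Theory.
Import numFieldNormedType.Exports.

Local Open Scope classical_set_scope.
Local Open Scope ring_scope.

(** Write u = f w and let g be (f - C)_+ outside the ball of radius N and 0
    inside; the bound on the collar N - 1 <= |n| < N + 1 makes g vanish for
    |n| < N + 1.  The ground state transform turns the sub- and supersolution
    inequalities into g_n * \sum_m w_m (g_n - g_m) <= 0, the sum running over
    the neighbours m of n.  Testing with w_n eta_n^2 for a cutoff eta gives
      \sum w_n w_m (g_n eta_n - g_m eta_m)^2
        <= \sum w_n w_m g_n g_m (eta_n - eta_m)^2
    over the edges nm.  As w g <= |u|, a cutoff decreasing linearly from M + 1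
    to alpha M - 1 bounds the right-hand side by a multiple of
    M^-2 * annulus_sum u alpha M, whose liminf is 0.  So g is constant along
    edges, hence identically g_0 = 0. *)

Set Implicit Arguments.
Unset Strict Implicit.
Unset Printing Implicit Defensive.

(** * The Euclidean norm and nearest neighbours in $\mathbb{Z}^d$ *)

Local Notation e_ j := (delta_mx 0 j : 'rV[int]__).

Lemma enorm_sqr (R : realType) (d : nat) (n : 'rV[int]_d) :
  enorm R n ^+ 2 = \sum_(i < d) ((n 0 i)%:~R : R) ^+ 2.
Proof. by rewrite sqr_sqrtr// sumr_ge0// => i _; exact: sqr_ge0. Qed.

Lemma enorm_ge0 (R : realType) (d : nat) (n : 'rV[int]_d) : 0 <= enorm R n.
Proof. exact: sqrtr_ge0. Qed.

Lemma enorm0 (R : realType) (d : nat) : enorm R (0 : 'rV[int]_d) = 0.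
Proof.
by rewrite /enorm big1 ?sqrtr0// => i _; rewrite mxE mulr0z expr0n.
Qed.

Lemma enormN (R : realType) (d : nat) (n : 'rV[int]_d) :
  enorm R (- n) = enorm R n.
Proof.
by congr Num.sqrt; apply: eq_bigr => i _; rewrite mxE mulrNz sqrrN.
Qed.

Lemma coord_le_enorm (R : realType) (d : nat) (n : 'rV[int]_d) (j : 'I_d) :
  (n 0 j)%:~R <= enorm R n.
Proof.
apply: le_trans (ler_norm _) _; rewrite -sqrtr_sqr ler_sqrt.
  by rewrite (bigD1 j)//= lerDl sumr_ge0// => i _; exact: sqr_ge0.
by rewrite sumr_ge0// => i _; exact: sqr_ge0.
Qed.

(** The squares of the two sides differ by $2(|n| - n_j)$, which [coord_le_enorm] makes
    nonnegative. *)
Lemma enorm_addE_le (R : realType) (d : nat) (n : 'rV[int]_d) (j : 'I_d) :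
  enorm R (n + e_ j) <= enorm R n + 1.
Proof.
have n0 := enorm_ge0 R n.
rewrite -(@ler_pXn2r _ 2) ?nnegrE ?enorm_ge0 ?addr_ge0//.
rewrite sqrrD1 !enorm_sqr (bigD1 j)//= [in leRHS](bigD1 j)//=.
rewrite !mxE !eqxx/= intrD.
rewrite (eq_bigr (fun i => (n 0 i)%:~R ^+ 2 : R)); last first.
  by move=> i ij; rewrite !mxE (negPf ij) andbF addr0.
have := coord_le_enorm R n j; set s := \sum_(i < d | _) _; lra.
Qed.

Lemma enorm_subE_le (R : realType) (d : nat) (n : 'rV[int]_d) (j : 'I_d) :
  enorm R (n - e_ j) <= enorm R n + 1.
Proof.
by have := enorm_addE_le R (- n) j; rewrite enormN -enormN opprD opprK.
Qed.

Lemma sphere1P (R : realType) (d : nat) (n : 'rV[int]_d) :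
  enorm R n = 1 <-> exists j, n = e_ j \/ n = - e_ j.
Proof.
have enormE j : enorm R (e_ j : 'rV[int]_d) = 1.
  rewrite /enorm (bigD1 j)//= big1 ?mxE ?eqxx ?addr0 ?expr1n ?sqrtr1//.
  by move=> i ij; rewrite mxE (negPf ij) andbF mulr0z expr0n.
split; last by case=> j [->|->]; rewrite ?enormN enormE.
move=> n1; have : enorm R n ^+ 2 = 1 by rewrite n1 expr1n.
rewrite enorm_sqr.
(* Moved to natural numbers, a sum of squares equal to 1 has exactly one nonzero term, and that term
   is 1. *)
under eq_bigr do rewrite -rmorphXn/= -[_ ^+ 2]gez0_abs ?sqr_ge0// abszX.
rewrite -rmorph_sum/= -(raddf_sum Posz)/=.
move=> /(@mulrIz _ 1 (oner_neq0 _) _ 1)[] /eqP /sum_nat_eq1[j [_ nj nij]].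
exists j; have {}nj : absz (n 0 j) = 1%N by move: nj; rewrite -mulnn; nia.
have [s s1 ->] : exists2 s : int, (s = 1) \/ (s = -1) & n = s *: e_ j.
  exists (n 0 j); first by lia.
  apply/rowP => i; rewrite !mxE/=; have [->|ij] := eqVneq i j.
    by rewrite mulr1.
  have /eqP := nij i ij isT; rewrite expn_eq0/= andbT; lia.
by case: s1 => ->; rewrite ?scaleN1r ?scale1r; [left|right].
Qed.

Lemma sum_neighbours (R : realType) (d : nat) (n : 'rV[int]_d)
    (F : 'rV[int]_d -> R) :
  \sum_(m \in [set m | enorm R (m - n) = 1]) F m =
  \sum_(j < d) (F (n + e_ j) + F (n - e_ j)).
Proof.
have dinj (i j : 'I_d) : (e_ i : 'rV[int]_d) = e_ j -> i = j.
  by move=> /rowP/(_ i); rewrite !mxE !eqxx/=; case: eqVneq.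
have dneg (i j : 'I_d) : (e_ i : 'rV[int]_d) <> - e_ j.
  by move=> /rowP/(_ i); rewrite !mxE !eqxx/=; case: eqVneq.
set A := range (fun j : 'I_d => n + e_ j).
set B := range (fun j : 'I_d => n - e_ j).
have -> : [set m | enorm R (m - n) = 1] = A `|` B.
  apply/seteqP; split => m /=.
    move=> /sphere1P[j [mj|mj]]; [left|right]; exists j => //;
    by rewrite -mj addrC subrK.
  by case=> -[j _ <-]; apply/sphere1P; exists j; rewrite addrC addKr; [left|right].
rewrite fsbigU/=; [|exact/finite_image/finite_finset..|]; last first.
  move=> _ [[i _ <-] [j _ /addrI]] ij.
  by case: (dneg i j).
rewrite big_split/= !fsbig_image/=.
- congr (_ + _); rewrite (fsbig_fwiden (index_enum 'I_d)) ?index_enum_uniq//.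
  + by move=> j _; rewrite /= mem_index_enum.
  + by move=> j [_]; case.
  + by move=> j _; rewrite /= mem_index_enum.
  + by move=> j [_]; case.
- by move=> i j _ _ /addrI/oppr_inj/dinj.
- by move=> i j _ _ /addrI/dinj.
Qed.

(** * Summation by parts and the energy estimate *)

Lemma big_shift (R : nmodType) (V : zmodType) (S : seq V) (F : V -> R) (a : V) :
  uniq S -> (forall n, F n != 0 -> n \in S) ->
  (forall n, F n != 0 -> n - a \in S) ->
  \sum_(n <- S) F (n + a) = \sum_(n <- S) F n.
Proof.
move=> uS FS FaS.
(* Both sums equal sums over the whole group, where translation is a bijection. *)
have sumT (G : V -> R) : (forall n, G n != 0 -> n \in S) ->
    \sum_(n <- S) G n = \sum_(n \in [set: V]) G n.
  move=> GS; rewrite fsbig_seq//; apply: fsbig_widen => // n [_ /= nS].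
  by apply: contra_notP nS => /eqP; exact: GS.
rewrite !sumT//; last by move=> n /FaS; rewrite addrK.
rewrite [RHS](reindex_fsbigT (fun n => n + a))//.
by exists (fun n => n - a) => n; rewrite ?addrK ?subrK.
Qed.

Lemma caccioppoli (R : realType) (d : nat) (w g eta : 'rV[int]_d -> R)
    (S : seq 'rV[int]_d) :
  (forall n, 0 <= w n) ->
  (forall n, g n * (\sum_(j < d) (w (n + e_ j) * (g n - g (n + e_ j)) +
                                  w (n - e_ j) * (g n - g (n - e_ j)))) <= 0) ->
  uniq S -> (forall n, eta n != 0 -> n \in S) ->
  (forall n j, eta n != 0 -> n + e_ j \in S) ->
  \sum_(n <- S) \sum_(j < d) w n * w (n - e_ j) *
      (g n * eta n - g (n - e_ j) * eta (n - e_ j)) ^+ 2 <=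
  \sum_(n <- S) \sum_(j < d) w n * w (n - e_ j) * g n * g (n - e_ j) *
      (eta n - eta (n - e_ j)) ^+ 2.
Proof.
move=> w0 gS uS etaS etaSj; rewrite -subr_le0 -sumrB.
(* [P] and [Q] are the contributions of the two ends $n$ and $n - \delta_j$ of an edge. *)
pose P j n := w n * w (n - e_ j) * (g n - g (n - e_ j)) * (g n * eta n ^+ 2).
pose Q j n := w n * w (n - e_ j) * (g (n - e_ j) - g n) *
  (g (n - e_ j) * eta (n - e_ j) ^+ 2).
(* (a - b) (a x^2 - b y^2) = (a x - b y)^2 - a b (x - y)^2 *)
rewrite (eq_bigr (fun n => \sum_(j < d) (P j n + Q j n))); last first.
  by move=> n _; rewrite -sumrB; apply: eq_bigr => j _; rewrite /P /Q; ring.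
rewrite exchange_big/=.
(* Shifting [Q] gathers at $n$ the terms of all edges meeting $n$; together they are $w_n\eta_n^2$
   times the left side of the hypothesis on [g]. *)
rewrite (eq_bigr (fun j => \sum_(n <- S) (P j n + Q j (n + e_ j)))); last first.
  move=> j _; rewrite !big_split/=; congr (_ + _); rewrite big_shift//.
  - move=> n Qn; rewrite -(subrK (e_ j) n); apply: etaSj.
    by apply: contraNneq Qn => eta0; rewrite /Q eta0 expr0n/= !mulr0.
  - move=> n Qn; apply: etaS.
    by apply: contraNneq Qn => eta0; rewrite /Q eta0 expr0n/= !mulr0.
rewrite exchange_big/= big_seq_cond; apply: sumr_le0 => n _.
rewrite (eq_bigr (fun j => w n * eta n ^+ 2 * (g n *
   (w (n + e_ j) * (g n - g (n + e_ j)) +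
    w (n - e_ j) * (g n - g (n - e_ j)))))); last first.
  by move=> j _; rewrite /P /Q addrK; ring.
rewrite -mulr_sumr -mulr_sumr mulr_ge0_le0//.
by rewrite mulr_ge0// sqr_ge0.
Qed.

(** The summands $n_j\delta_j$ of $n$ are removed one at a time, each by induction on the integer
    $n_j$. *)
Lemma shift_invariant_const (T : Type) (d : nat) (g : 'rV[int]_d -> T) :
  (forall n j, g n = g (n - e_ j)) -> forall n, g n = g 0.
Proof.
move=> gE n; rewrite [n]row_sum_delta.
have gz m (z : int) j : g (z *: e_ j + m) = g m.
  elim/int_ind: z => [|k IH|k IH]; first by rewrite scale0r add0r.
    by rewrite -IH intS scalerDl scale1r -addrA (gE _ j) (addrC (e_ j)) addrK.
  by rewrite -IH intS opprD scalerDl scaleN1r -addrA addrC -gE.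
by elim/big_rec: _ => // j m _ <-; rewrite gz.
Qed.

(** * Linear cutoffs, the lower limit and annulus sums *)

Definition cutoff (R : realType) (a b t : R) : R :=
  Num.max 0 (Num.min 1 ((b - t) / (b - a))).

Lemma cutoff1 (R : realType) (a b t : R) : a < b -> t <= a -> cutoff a b t = 1.
Proof.
move=> ab ta; rewrite /cutoff min_l ?max_r//.
by rewrite ler_pdivlMr ?subr_gt0// mul1r lerB.
Qed.

Lemma cutoff0 (R : realType) (a b t : R) : a < b -> b <= t -> cutoff a b t = 0.
Proof.
move=> ab bt; rewrite /cutoff max_l// ge_min; apply/orP; right.
by rewrite pmulr_lle0 ?invr_gt0 ?subr_gt0// subr_le0.
Qed.

(** Clamping to $[0,1]$ is 1-Lipschitz, so the slope of the affine function inside gives the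
    bound. *)
Lemma cutoff_lip (R : realType) (a b s t : R) : a < b ->
  `|s - t| <= 1 -> (cutoff a b s - cutoff a b t) ^+ 2 <= (b - a) ^- 2.
Proof.
move=> ab st; have c0 : 0 <= (b - a)^-1 by rewrite invr_ge0 subr_ge0 ltW.
rewrite -exprVn -ler_sqrt ?sqr_ge0// !sqrtr_sqr (ger0_norm c0).
apply: (@le_trans _ _ `|(b - s) / (b - a) - (b - t) / (b - a)|).
  rewrite /cutoff; set x := _ / _; set y := _ / _.
  have := ler_norm (x - y); have := ler_norm (y - x).
  rewrite [`|y - x|]distrC ler_norml !maxEle !minEle.
  by case: (leP 1 x); case: (leP 1 y); rewrite ?ler01; case: (leP 0 x);
    case: (leP 0 y) => *; lra.
rewrite -mulrBl normrM (ger0_norm c0) ler_piMl//.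
by rewrite opprB addrC addrA subrK distrC.
Qed.

(** If [F] stayed at least [eps] from [K] on, the infimum over that half-line, and hence the lower
    limit, would be at least [eps]. *)
Lemma liminf0_frequently (R : realType) (F : R -> R) :
  limf_einf (fun M => (F M)%:E) +oo = 0%E ->
  forall eps K : R, 0 < eps -> exists2 M, K <= M & F M < eps.
Proof.
move=> F0 eps K eps0; apply: contrapT => nF.
suff : (eps%:E <= 0)%E by rewrite lee_fin leNgt eps0.
rewrite -F0 limf_einfE; apply: ereal_sup_ge.
exists (ereal_inf [set (F M)%:E | M in [set M | K <= M]]).
  by exists [set M | K <= M] => //; exact/nbhs_pinfty_ge/num_real.
apply: le_ereal_inf_tmp => _ [M KM <-]; rewrite lee_fin leNgt.
by apply/negP => FM; apply: nF; exists M.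
Qed.

Lemma finite_set_has_ubound (R : realType) (A : set R) :
  finite_set A -> has_ubound A.
Proof.
move=> finA; exists (\big[Num.max/0]_(x <- finmap.enum_fset (fset_set A)) x).
move=> x Ax; apply: (@le_bigmax_seq _ _ _ _ _ x xpredT id) => //.
by rewrite in_fset_set// inE.
Qed.

(** Enumerates the same ball as the energy sums in [liouville], for a termwise comparison. *)
Lemma annulus_sumE (R : realType) (d : nat) (u : 'rV[int]_d -> R)
    (alpha M : R) :
  annulus_sum u alpha M =
  \sum_(n <- finmap.enum_fset (fset_set [set n | enorm R n <= alpha * M]) | M <= enorm R n)
    \sum_(j < d) `|u n * u (n - e_ j)|.
Proof.
rewrite /annulus_sum; have -> : [set n : 'rV_d | M <= enorm R n <= alpha * M] =
    [set n | enorm R n <= alpha * M] `&` [set n | M <= enorm R n].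
  by apply/seteqP; split => n /= => [/andP[]|[-> ->]].
rewrite fsbig_mkcondr fsbig_finite/=; last exact: finite_enorm_ball.
by rewrite [RHS]big_mkcond/=; apply: eq_bigr => n _; rewrite mem_setE.
Qed.

(** * Constancy of [g] *)

Lemma liouville (R : realType) (d : nat) (w g u : 'rV[int]_d -> R)
    (alpha : R) :
  (forall n, 0 < w n) -> (forall n, 0 <= g n) ->
  (forall n, w n * g n <= `|u n|) ->
  (forall n, g n * (\sum_(j < d) (w (n + e_ j) * (g n - g (n + e_ j)) +
                                  w (n - e_ j) * (g n - g (n - e_ j)))) <= 0) ->
  1 < alpha ->
  limf_einf (fun M : R => (1 / M ^+ 2 * annulus_sum u alpha M)%:E) +oo = 0%E ->
  forall n, g n = g 0.
Proof.
move=> w0 g0 wgu gS alpha1 u_small; apply: shift_invariant_const => n0 j0.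
apply: contrapT => /eqP; rewrite -subr_eq0 => gn0.
(* An edge along which [g] varies contributes [D] to the energy for every large [M]. *)
pose D := w n0 * w (n0 - e_ j0) * (g n0 - g (n0 - e_ j0)) ^+ 2.
have D0 : 0 < D by rewrite mulr_gt0 ?exprn_even_gt0// mulr_gt0.
have al0 : 0 < alpha - 1 by rewrite subr_gt0.
have n00 := enorm_ge0 R n0.
have eps0 : 0 < D * (alpha - 1) ^+ 2 / 4 by rewrite divr_gt0// mulr_gt0// exprn_gt0.
(* The term $1 + |n_0|$ puts both ends of the chosen edge where the cutoff is 1. The term
   $4/(\alpha-1)$ ensures $b - a = M(\alpha-1) - 2 \geq M(\alpha-1)/2$, whose square explains the
   factor $(\alpha-1)^2/4$ in the tolerance. *)
have [M KM] := liminf0_frequently u_small (1 + enorm R n0 + 4 / (alpha - 1)) eps0.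
have q0 : 0 < 4 / (alpha - 1) by rewrite divr_gt0.
have M0 : 0 < M by lra.
have alM : 4 <= M * (alpha - 1) by rewrite -ler_pdivrMr//; lra.
rewrite mulrC mul1r ltr_pdivrMr ?exprn_gt0//; apply/negP; rewrite -leNgt.
(* The unit margins absorb one lattice step: if $|n| < M$ then [eta] is 1 at $n$ and $n - \delta_j$,
   and neighbours of the support of [eta] stay in the ball of radius $\alpha M$. *)
pose a := M + 1; pose b := alpha * M - 1.
have ab : a < b by rewrite /a /b; lra.
have ba : M * (alpha - 1) / 2 <= b - a by rewrite /a /b; lra.
pose eta (n : 'rV[int]_d) := cutoff a b (enorm R n).
pose S : seq 'rV[int]_d :=
  finmap.enum_fset (fset_set [set n | enorm R n <= alpha * M]).
have memS n : (n \in S) = (enorm R n <= alpha * M).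
  by rewrite in_fset_set ?mem_setE//; exact: finite_enorm_ball.
have eta_supp n : eta n != 0 -> enorm R n < b.
  by rewrite ltNge; apply: contraNN => bn; rewrite /eta cutoff0.
have etaS n : eta n != 0 -> n \in S.
  by move=> /eta_supp; rewrite memS /b; lra.
have etaSj n j : eta n != 0 -> n + e_ j \in S.
  by move=> /eta_supp; rewrite memS /b; have := enorm_addE_le R n j; lra.
have := caccioppoli (fun n => ltW (w0 n)) gS (finmap.fset_uniq _) etaS etaSj.
have n0S : n0 \in S by rewrite memS; nra.
have W0 n j : 0 <= w n * w (n - e_ j) by rewrite mulr_ge0// ltW.
have term_ge0 n j : 0 <= w n * w (n - e_ j) *
    (g n * eta n - g (n - e_ j) * eta (n - e_ j)) ^+ 2.
  by rewrite mulr_ge0// sqr_ge0.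
set E := (X in X <= _); have DE : D <= E.
  have etan0 : eta n0 = 1 by rewrite /eta cutoff1// /a; lra.
  have etanj : eta (n0 - e_ j0) = 1.
    by rewrite /eta cutoff1// /a; have := enorm_subE_le R n0 j0; lra.
  rewrite /E (bigD1_seq n0 n0S (finmap.fset_uniq _))//= (bigD1 j0)//=.
  rewrite {1}etan0 {1}etanj !mulr1 -addrA lerDl addr_ge0//.
    by apply: sumr_ge0 => j _; exact: term_ge0.
  by apply: sumr_ge0 => n _; apply: sumr_ge0 => j _; exact: term_ge0.
move=> /(le_trans DE); set F := (X in _ <= X).
have FA : F <= (b - a) ^- 2 * annulus_sum u alpha M.
  rewrite /F annulus_sumE mulr_sumr [leRHS]big_mkcond/= -/S.
  rewrite !big_seq; apply: ler_sum => n; rewrite memS => nM.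
  have eta_lip j : (eta n - eta (n - e_ j)) ^+ 2 <= (b - a) ^- 2.
    apply: cutoff_lip => //; have := enorm_subE_le R n j.
    by have := enorm_addE_le R (n - e_ j) j; rewrite subrK ler_norml; lra.
  case: ifPn => Mn.
    rewrite mulr_sumr; apply: ler_sum => j _.
    rewrite mulrC ler_pM ?sqr_ge0// ?mulr_ge0 ?(ltW (w0 _))//.
    by rewrite normrM -mulrA mulrACA ler_pM ?mulr_ge0 ?(ltW (w0 _)).
  (* Inside radius [M] the cutoff is 1 at both ends, so only the annulus contributes. *)
  rewrite -ltNge in Mn; rewrite big1// => j _.
  have -> : eta n = 1 by rewrite /eta cutoff1// /a; lra.
  have -> : eta (n - e_ j) = 1.
    by rewrite /eta cutoff1// /a; have := enorm_subE_le R n j; lra.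
  by rewrite subrr expr0n mulr0.
move=> /le_trans/(_ FA); set A := annulus_sum _ _ _ => DA.
have ba0 : 0 < b - a by rewrite subr_gt0.
have : D * (b - a) ^+ 2 <= A.
  by rewrite -ler_pdivlMr ?exprn_gt0// mulrC.
apply: le_trans.
rewrite (_ : _ * M ^+ 2 = D * (M * (alpha - 1) / 2) ^+ 2); last by field.
by rewrite ler_pM2l// ler_pXn2r ?nnegrE//; lra.
Qed.

(** * Comparison of [u] with [C w] *)

Theorem theorem8 (R : realType) (d : nat) (V : 'rV[int]_d -> R) (N : nat)
    (lambda : R) (w u : 'rV[int]_d -> R)
    (w_gt0 : forall n, 0 < w n)
    (w_super : supersolution V lambda (outside_ball R N) w)
    (u_sub : subsolution V lambda (outside_ball R N) u)
    (u_small : exists2 alpha : R, 1 < alpha &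
      limf_einf (fun M : R => (1 / M ^+ 2 * annulus_sum u alpha M)%:E)
        +oo = 0%E) :
  forall C : R, 0 < C ->
    sup [set u n / w n | n in
      [set n : 'rV[int]_d | N%:R - 1 <= enorm R n < N%:R + 1]] <= C ->
    forall n : 'rV[int]_d, outside_ball R N n -> u n <= C * w n.
Proof.
move=> C C0 supC.
have [alpha alpha1 u0] := u_small.
have collar n : N%:R - 1 <= enorm R n < N%:R + 1 -> u n <= C * w n.
  move=> nN; rewrite -ler_pdivrMr//; apply: le_trans supC.
  (* Finiteness of the collar bounds the quotients, so [sup] is a genuine upper bound and not a
     default value. *)
  apply: ub_le_sup; last by exists n.
  apply: finite_set_has_ubound; apply: finite_image.
  apply: (sub_finite_set _ (finite_enorm_ball d (N%:R + 1))) => m /= /andP[_].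
  exact: ltW.
pose v n := Num.max 0 (u n / w n - C).
pose g n := if enorm R n < N%:R then 0 else v n.
have g0 n : 0 <= g n by rewrite /g; case: ifP => // _; rewrite le_max lexx.
have gE n : N%:R <= enorm R n -> g n = v n by rewrite /g ltNge => ->.
have v_collar n : N%:R - 1 <= enorm R n < N%:R + 1 -> v n = 0.
  by move=> /collar un; rewrite /v max_l// subr_le0 ler_pdivrMr.
have g_in n : enorm R n < N%:R + 1 -> g n = 0.
  move=> nN; rewrite /g; case: ltP => // Nn; apply: v_collar.
  by rewrite nN andbT; lra.
have wgu n : w n * g n <= `|u n|.
  rewrite /g; case: ifP => _; first by rewrite mulr0.
  rewrite /v maxEle; case: ifP => _; last by rewrite mulr0.
  rewrite mulrBr mulrCA divff ?mulr1 ?gt_eqF//.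
  have := ler_norm (u n); have := mulr_gt0 (w_gt0 n) C0; lra.
have gS n : g n * (\sum_(j < d) (w (n + e_ j) * (g n - g (n + e_ j)) +
    w (n - e_ j) * (g n - g (n - e_ j)))) <= 0.
  have [->|gn] := eqVneq (g n) 0; first by rewrite mul0r.
  (* Where [g] is nonzero, every neighbour is still at distance at least [N], so the truncation
     inside the ball is not seen. *)
  have nN : N%:R + 1 <= enorm R n.
    by rewrite leNgt; apply: contraNN gn => /g_in ->.
  have gnE : g n = u n / w n - C.
    move: gn; rewrite gE ?/v; last by lra.
    by rewrite maxEle; case: ifP => //; rewrite eqxx.
  rewrite mulr_ge0_le0//.
  have Nn : outside_ball R N n by rewrite /outside_ball/=; lra.
  have := w_super _ Nn; have := u_sub _ Nn.
  rewrite /schrodinger !sum_neighbours.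
  set Su := \sum_(j < d) _; set Sw := \sum_(j < d) _ => Hu Hw.
  have w0 := w_gt0 n.
  set f := u n / w n.
  have fw : u n = f * w n by rewrite divfK// gt_eqF.
  have gn_gt0 : 0 < g n by rewrite lt_def gn g0.
  have f0 : 0 < f by move: gn_gt0; rewrite gnE -/f; lra.
  (* Subtracting $f = u_n/w_n > 0$ times the inequality for [w] from that for [u] cancels the
     potential and [lambda]. *)
  have Suw : Su - f * Sw <= 0.
    have := mulr_ge0 (ltW f0) Hw; rewrite fw in Hu; lra.
  apply: le_trans Suw; rewrite mulr_sumr -sumrB; apply: ler_sum => j _.
  (* Combine $g_n = f - C$ with $w_m g_m \geq u_m - C w_m$; the constant [C] cancels. *)
  have step m : N%:R <= enorm R m ->
      w m * (g n - g m) <= u n - u m - f * (w n - w m).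
    move=> Nm; have wm := w_gt0 m.
    have : u m / w m - C <= g m by rewrite gE// le_max lexx orbT.
    rewrite -(ler_pM2l wm) mulrBr mulrCA divff ?gt_eqF//.
    rewrite gnE -/f fw; lra.
  have := step (n + e_ j); have := step (n - e_ j).
  have := enorm_addE_le R (n - e_ j) j; have := enorm_subE_le R (n + e_ j) j.
  rewrite addrK subrK => a1 a2.
  by move=> /(_ ltac:(lra)) s1 /(_ ltac:(lra)) s2; lra.
move=> n Nn.
(* The constant value of [g] is read off at the origin, since $0 < N + 1$. *)
have gn0 : g n = 0.
  by rewrite (liouville w_gt0 g0 wgu gS alpha1 u0) g_in// enorm0 natr1 ltr0n.
have : u n / w n - C <= 0 by rewrite -gn0 gE// le_max lexx orbT.
by rewrite subr_le0 ler_pdivrMr.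
Qed.
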